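(* Let $a\le 0$ be an integer. Define $a_{\mathcal{M}}(n)$, $n\ge 0$, by $a_{\mathcal{M}}(0)=1$, $a_{\mathcal{M}}(1)=-1$, $a_{\mathcal{M}}(2)=a$ and, for $n\ge3$, $a_{\mathcal{M}}(n)=-\frac{1}{2}\sum_{k=0}^{n-1}a_{\mathcal{M}}(k)\binom{n}{k}2^{n-k}$. For integers $0\le j\le d$ set $c_{\mathcal{M}}(j,d)=\sum_{k=j}^d2^{-k}\binom{d-j}{d-k}a_{\mathcal{M}}(k)$. Then for all $m\ge1$: $$0=c_{\mathcal{M}}(0,4m)\le c_{\mathcal{M}}(1,4m)\le\cdots\le c_{\mathcal{M}}(2m,4m),$$ $$0\le c_{\mathcal{M}}(2m,4m+1)\le c_{\mathcal{M}}(2m-1,4m+1)\le\cdots\le c_{\mathcal{M}}(0,4m+1),$$ $$0=c_{\mathcal{M}}(0,4m+2)\ge c_{\mathcal{M}}(1,4m+2)\ge\cdots\ge c_{\mathcal{M}}(2m+1,4m+2),$$ $$0\ge c_{\mathcal{M}}(2m+1,4m+3)\ge c_{\mathcal{M}}(2m,4m+3)\ge\cdots\ge c_{\mathcal{M}}(0,4m+3).$$ *)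

(* Defs.v *)
From mathcomp Require Import all_boot all_order all_algebra.

Set Implicit Arguments.
Unset Strict Implicit.
Unset Printing Implicit Defensive.

Import Order.TTheory GRing.Theory Num.Theory.
Local Open Scope ring_scope.

Definition aM_step (a : int) (f : nat -> rat) (n : nat) : rat :=
  match n with
  | 0 => 1
  | 1 => -1
  | 2 => a%:~R
  | _ => - (1 / 2) * \sum_(0 <= k < n) f k * 'C(n, k)%:R * 2 ^+ (n - k)
  end.

(* Course-of-values recursion: aM_prefix a n = [:: aM a 0; ...; aM a n.-1]. *)
Fixpoint aM_prefix (a : int) (n : nat) : seq rat :=
  if n is n'.+1 then
    let s := aM_prefix a n' in rcons s (aM_step a (nth 0 s) n')
  else [::].

Definition aM (a : int) (n : nat) : rat := nth 0 (aM_prefix a n.+1) n.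

Definition cM (a : int) (j d : nat) : rat :=
  \sum_(j <= k < d.+1) 2 ^- k * 'C(d - j, d - k)%:R * aM a k.

Lemma size_aM_prefix a n : size (aM_prefix a n) = n.
Proof. by elim: n => //= n IHn; rewrite size_rcons IHn. Qed.

Lemma nth_aM_prefix a n k : (k < n)%N -> nth 0 (aM_prefix a n) k = aM a k.
Proof.
elim: n => // n IHn; rewrite ltnS leq_eqVlt => /orP[/eqP-> //|lt_kn].
by rewrite /= nth_rcons size_aM_prefix lt_kn IHn.
Qed.

Lemma aM_stepE a n : aM a n = aM_step a (nth 0 (aM_prefix a n)) n.
Proof. by rewrite /aM /= nth_rcons size_aM_prefix ltnn eqxx. Qed.

Lemma aM0 a : aM a 0 = 1. Proof. by []. Qed.
Lemma aM1 a : aM a 1 = -1. Proof. by []. Qed.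
Lemma aM2 a : aM a 2 = a%:~R. Proof. by []. Qed.

Lemma aM_rec a n : (3 <= n)%N ->
  aM a n = - (1 / 2) * \sum_(0 <= k < n) aM a k * 'C(n, k)%:R * 2 ^+ (n - k).
Proof.
case: n => [|[|[|n]]] // _.
rewrite aM_stepE /aM_step; congr (_ * _).
by apply: eq_big_nat => k lt_kn; rewrite nth_aM_prefix.
Qed.

(* Main.v *)
Require Import Defs.
From mathcomp Require Import all_boot all_order all_algebra.
From mathcomp Require Import zify ring lra.

Import Order.TTheory GRing.Theory Num.Theory.
Local Open Scope ring_scope.

(** The numbers [cM a j d] form a Seidel triangle: [c(j,d) - c(j+1,d) = c(j,d-1)],
    so every claimed monotonicity in row [d] is a sign condition on row [d-1].
    The recurrence for [aM] reads [c(0,d) = - c(d,d)] for [d >= 3], and it forces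
    the symmetry [c(d-j,d) = (-1)^d c(j,d)].  Hence an even row [d >= 4] starts
    with [0], the middle entries of an odd row are opposite to each other, and
    the signs propagate from row to row: inwards from [j = 0] in even rows,
    outwards from the middle in odd rows. *)

(** Pascal's rule on the binomial coefficients in row [d.+1]. *)
Lemma cM_recl (a : int) (j d : nat) : (j <= d)%N ->
  cM a j d.+1 = cM a j d + cM a j.+1 d.+1.
Proof.
move=> le_jd; rewrite /cM.
(* The added term [k = j] carries ['C(d - j, d.+1 - j) = 0], so both sums get the same range. *)
have -> : \sum_(j.+1 <= k < d.+2)
    2 ^- k * 'C(d.+1 - j.+1, d.+1 - k)%:R * aM a k =
  \sum_(j <= k < d.+2) 2 ^- k * 'C(d - j, d.+1 - k)%:R * aM a k.
  rewrite [RHS]big_ltn ?ltnS 1?ltnW // bin_small; last by rewrite subSn.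
  by rewrite mulr0 mul0r add0r.
rewrite [LHS]big_nat_recr ?leqW // [X in _ + X]big_nat_recr ?leqW //=.
rewrite subnn !bin0 addrA; congr (_ + _); rewrite -big_split /=.
apply: eq_big_nat => k /andP[_ lt_kd].
by rewrite !subSn // binS natrD mulrDr mulrDl addrC.
Qed.

Lemma cMnn (a : int) (d : nat) : cM a d d = 2 ^- d * aM a d.
Proof. by rewrite /cM big_nat1 !subnn mulr1. Qed.

Lemma cM0n (a : int) (d : nat) : (3 <= d)%N -> cM a 0 d = - cM a d d.
Proof.
move=> d_ge3; rewrite cMnn /cM big_nat_recr //= subn0 subnn bin0 mulr1.
have -> : \sum_(0 <= k < d) 2 ^- k * 'C(d, d - k)%:R * aM a k =
    2 ^- d * \sum_(0 <= k < d) aM a k * 'C(d, k)%:R * 2 ^+ (d - k).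
  rewrite big_distrr /=; apply: eq_big_nat => k /andP[_ lt_kd].
  rewrite bin_sub 1?ltnW // -[in 2 ^- d](subnK (ltnW lt_kd)) exprD.
  by field; rewrite !expf_neq0.
rewrite (aM_rec _ d_ge3); field; exact: expf_neq0.
Qed.

Lemma cM_sym (a : int) (d j : nat) : (j <= d)%N ->
  cM a (d - j) d = (-1) ^+ d * cM a j d.
Proof.
elim: d j => [|d IHd] j; first by rewrite leqn0 => /eqP->; rewrite mul1r.
pose D i := cM a i d.+1 - (-1) ^+ d.+1 * cM a (d.+1 - i) d.+1.
have signK : (-1) ^+ d * (-1) ^+ d = 1 :> rat by rewrite -expr2 sqrr_sign.
(* By [cM_recl], consecutive values of [D] differ by a symmetry defect of row [d], zero by
   induction. *)
have Dconst i : (i <= d.+1)%N -> D i = D 0%N.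
  elim: i => // i IHi lt_id; rewrite -IHi 1?ltnW // /D subSS.
  rewrite (@cM_recl a i d) // (@subSn i d) //.
  have:= @cM_recl a (d - i) d (leq_subr _ _).
  rewrite IHd // exprS => ->.
  rewrite mulrDr mulrA mulN1r mulNr signK; ring.
have D0 : D 0%N = 0.
  have:= Dconst d.+1 (leqnn _); rewrite /D subn0 subnn exprS mulN1r.
  (* For odd [d], [D d.+1 = - D 0], so the constant vanishes. For even [d], [D 0 = 0] is [cM0n],
     except in row 1, which is computed. *)
  rewrite -signr_odd; have [odd_d|even_d] := boolP (odd d).
    by rewrite expr1; lra.
  rewrite expr0 => _; case: d even_d {IHd D signK Dconst} => [|[|d]] // _.
    by rewrite /cM unlock.
  by rewrite cM0n //; ring.
move=> le_jd; have:= Dconst (d.+1 - j)%N (leq_subr _ _).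
by rewrite D0 /D subKn // => /eqP; rewrite subr_eq0 => /eqP.
Qed.

(** The two ends of the row are equal by symmetry and opposite by [cM0n]. Row 2 is excluded: there
    the entry is [a / 4]. *)
Lemma cM0_even (a : int) (n : nat) : (2 <= n)%N -> cM a 0 (2 * n) = 0.
Proof.
move=> n_ge2; have:= @cM_sym a (2 * n) 0 (leq0n _).
have:= @cM0n a (2 * n) _; rewrite subn0 exprM sqrrN !expr1n.
by move=> /(_ ltac:(lia)); lra.
Qed.

Lemma cM_mid_odd (a : int) (n : nat) :
  cM a n (2 * n) = 2 * cM a n (2 * n).+1.
Proof.
have:= @cM_sym a (2 * n).+1 n ltac:(lia).
have -> : ((2 * n).+1 - n = n.+1)%N by lia.
rewrite exprS exprM sqrrN !expr1n => sym.
by have:= @cM_recl a n (2 * n) ltac:(lia); rewrite sym; lra.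
Qed.

Lemma cM_sign_odd (a : int) (s : rat) (n : nat) :
    (forall j, (j <= n)%N -> 0 <= s * cM a j (2 * n)) ->
  forall j, (j <= n)%N -> 0 <= s * cM a j (2 * n).+1.
Proof.
(* With [j] written as [n - i], induction on [i] runs outwards from the middle. *)
move=> sgn j le_jn; rewrite -(subKn le_jn).
elim: (n - j)%N (leq_subr j n) => [_|i IHi lt_in].
  by have:= sgn n (leqnn _); rewrite subn0 cM_mid_odd; lra.
have:= sgn (n - i.+1)%N (leq_subr _ _); have:= IHi (ltnW lt_in).
rewrite (@cM_recl a (n - i.+1) (2 * n)) ?subnSK //; last by lia.
by lra.
Qed.

Lemma cM_sign_even (a : int) (s : rat) (n : nat) : (1 <= n)%N ->
    (forall j, (j <= n)%N -> 0 <= s * cM a j (2 * n).+1) ->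
  forall j, (j <= n.+1)%N -> 0 <= - s * cM a j (2 * n.+1).
Proof.
move=> n_gt0 sgn; elim=> [|j IHj] lt_jn; first by rewrite cM0_even // mulr0.
have:= sgn j lt_jn; have:= IHj (ltnW lt_jn).
rewrite mulnS !add2n (@cM_recl a j (2 * n).+1); last by lia.
by lra.
Qed.

Lemma cM_sign (a : int) (n : nat) : a <= 0 -> (1 <= n)%N ->
  forall j, (j <= n)%N -> 0 <= (-1) ^+ n * cM a j (2 * n).
Proof.
move=> a_le0; elim: n => // -[_ _|n IHn _].
  (* Base row 2: the entries are [a / 4] and [a / 4 - 1 / 2]; the sign of [a] enters here. *)
  have a_le0Q : a%:~R <= 0 :> rat by rewrite lerz0.
  case=> [|[|//]] _; rewrite /cM unlock /= /aM /= muln1 ?subn0 ?subn1 ?subnn /=;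
  by rewrite ?binn ?bin1 bin0; lra.
rewrite exprS mulN1r; apply: cM_sign_even => //.
exact/cM_sign_odd/IHn.
Qed.

Theorem mainTheorem10 (a : int) (ha : a <= 0) (m : nat) (hm : (1 <= m)%N) :
  [/\ 0 = cM a 0 (4 * m) /\
      (forall j : nat, (j < 2 * m)%N ->
         cM a j (4 * m) <= cM a j.+1 (4 * m)),
      0 <= cM a (2 * m) (4 * m + 1) /\
      (forall j : nat, (j < 2 * m)%N ->
         cM a j.+1 (4 * m + 1) <= cM a j (4 * m + 1)),
      0 = cM a 0 (4 * m + 2) /\
      (forall j : nat, (j < 2 * m + 1)%N ->
         cM a j (4 * m + 2) >= cM a j.+1 (4 * m + 2)) &
      0 >= cM a (2 * m + 1) (4 * m + 3) /\
      (forall j : nat, (j < 2 * m + 1)%N ->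
         cM a j.+1 (4 * m + 3) >= cM a j (4 * m + 3))].
Proof.
have sgn_even k : (-1) ^+ (2 * k) = 1 :> rat by rewrite exprM sqrrN !expr1n.
have sgn_odd k : (-1) ^+ (2 * k).+1 = -1 :> rat by rewrite exprS sgn_even mulr1.
have oddP n j : (1 <= n)%N -> (j <= n)%N -> 0 <= (-1) ^+ n * cM a j (2 * n).+1.
  by move=> n_gt0; apply: cM_sign_odd => i; apply: cM_sign.
have row0 : (4 * m = 2 * (2 * m))%N by lia.
have row2 : (4 * m + 2 = 2 * (2 * m).+1)%N by lia.
split; split.
- by rewrite row0 cM0_even //; lia.
(* The previous row is [4m - 1 = 2(2m - 1) + 1]; the form [(2 * m.-1).+1] of [2m - 1] fits
   [sgn_odd]. *)
- move=> j lt_j; have:= oddP (2 * m.-1).+1 j isT ltac:(lia).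
  have -> : (4 * m = (2 * (2 * m.-1).+1).+2)%N by lia.
  by rewrite sgn_odd (@cM_recl a j (2 * (2 * m.-1).+1).+1) ?mulN1r; [lra|lia].
- by have:= oddP (2 * m)%N (2 * m)%N ltac:(lia) (leqnn _);
     rewrite -row0 sgn_even mul1r addn1.
- move=> j lt_j; have:= @cM_sign a (2 * m) ha ltac:(lia) j (ltnW lt_j).
  by rewrite -row0 sgn_even addn1 (@cM_recl a j (4 * m)) ?mul1r; [lra|lia].
- by rewrite row2 cM0_even //; lia.
- move=> j lt_j; have:= oddP (2 * m)%N j ltac:(lia) ltac:(lia).
  by rewrite -row0 sgn_even addn2 (@cM_recl a j (4 * m).+1) ?mul1r; [lra|lia].
- have:= oddP (2 * m).+1 (2 * m).+1 isT (leqnn _).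
  by rewrite -row2 sgn_odd mulN1r oppr_ge0 addn1 -addnS.
- move=> j lt_j; have:= @cM_sign a (2 * m).+1 ha isT j ltac:(lia).
  by rewrite -row2 sgn_odd (addnS _ 2) (@cM_recl a j (4 * m + 2)) ?mulN1r; [lra|lia].
Qed.
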